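(* The optimal tree size problem (OTS) is coNP-hard both for DPLL and for backtracking. Here OTS is: given a CNF formula $F$ and an integer $k$ written in binary, decide whether $F$ has a search tree (a backtracking search tree, resp. a DPLL search tree) of size at most $k$.
   Context: A CNF formula is a finite set of clauses; the empty clause is unsatisfiable. For a partial assignment $I$ (set of literals), $F|I$ is obtained by deleting clauses containing a literal true under $I$ and deleting false literals from remaining clauses. $Var(F)$ is the set of variables of $F$. A binary tree is empty $()$ or a triple $(x~T_1~T_2)$; its size is its number of nodes. A backtracking search tree (BST) of $F$ is: $()$ if $F$ contains the empty clause; otherwise $(x~T_1~T_2)$ with $x \in Var(F)$, $T_1$ a BST of $F|\{\neg x\}$, $T_2$ a BST of $F|\{x\}$. $D(F)$ denotes the formula obtained from $F$ by exhaustively applying unit propagation and the monotone (pure) literal rule. A DPLL search tree (DST) of $F$ is: $()$ if $D(F)$ contains the empty clause; otherwise $(x~T_1~T_2)$ with $x\in Var(D(F))$, $T_1$ a DST of $D(F|\{\neg x\})$ and $T_2$ a DST of $D(F|\{x\})$. *)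

(* Defs.v *)
From mathcomp Require Import all_boot.
Set Implicit Arguments. Unset Strict Implicit. Unset Printing Implicit Defensive.

(* A literal is (v, pol): pol = true means the positive literal v,
   pol = false means the negative literal ~v. *)
Definition lit := (nat * bool)%type.
Definition clause := seq lit.          (* read as the set of its elements *)
Definition cnf := seq clause.          (* read as the set of its elements *)

Definition neg (l : lit) : lit := (l.1, ~~ l.2).

Definition assign (F : cnf) (l : lit) : cnf :=
  [seq [seq m <- C | m != neg l] | C <- F & l \notin C].

Definition has_empty (F : cnf) : bool := [::] \in F.

Definition vars (F : cnf) : seq nat := undup [seq m.1 | m <- flatten F].

Definition unit_lit (F : cnf) : option lit :=
  if [seq C <- F | size (undup C) == 1] is C :: _ then ohead C else None.

Definition pure_lit (F : cnf) : option lit :=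
  ohead [seq l <- flatten F | neg l \notin flatten F].

Definition dstep (F : cnf) : option cnf :=
  if has_empty F then None else
  match unit_lit F with
  | Some l => Some (assign F l)
  | None => match pure_lit F with
            | Some l => Some (assign F l)
            | None => None
            end
  end.

Fixpoint iterD (n : nat) (F : cnf) : cnf :=
  match n with
  | 0 => F
  | n'.+1 => match dstep F with Some G => iterD n' G | None => F end
  end.

(* every step strictly decreases the total number of literal occurrences,
   so this fuel suffices to reach the fixpoint *)
Definition D (F : cnf) : cnf := iterD (size (flatten F)).+1 F.

Inductive tree : Type := Leaf | Node of nat & tree & tree.

Fixpoint tsize (t : tree) : nat :=
  match t with Leaf => 0 | Node _ a b => (tsize a + tsize b).+1 end.

Fixpoint is_BST (F : cnf) (T : tree) : Prop :=
  match T with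
  | Leaf => has_empty F
  | Node x T1 T2 => ~~ has_empty F /\ x \in vars F /\
      is_BST (assign F (x, false)) T1 /\ is_BST (assign F (x, true)) T2
  end.

Fixpoint is_DST (F : cnf) (T : tree) : Prop :=
  match T with
  | Leaf => has_empty (D F)
  | Node x T1 T2 => ~~ has_empty (D F) /\ x \in vars (D F) /\
      is_DST (D (assign F (x, false))) T1 /\ is_DST (D (assign F (x, true))) T2
  end.

Definition word := seq bool.

Fixpoint bits_aux (fuel n : nat) : word :=
  match fuel with
  | 0 => [::]
  | f.+1 => if n == 0 then [::] else odd n :: bits_aux f n./2
  end.
Definition binary (n : nat) : word := bits_aux n n.

Definition D0 : word := [:: true; false].
Definition D1 : word := [:: true; true].
Definition SEP : word := [:: false; false].
Definition ENDc : word := [:: false; true].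
Definition enc_bit (b : bool) : word := if b then D1 else D0.

Definition enc_nat (n : nat) : word := flatten [seq enc_bit b | b <- binary n].
Definition enc_lit (l : lit) : word := enc_bit l.2 ++ enc_nat l.1 ++ SEP.
Definition enc_clause (C : clause) : word := flatten [seq enc_lit l | l <- C] ++ ENDc.
Definition enc_cnf (F : cnf) : word := flatten [seq enc_clause C | C <- F] ++ SEP.
Definition encode (F : cnf) (k : nat) : word := enc_cnf F ++ enc_nat k.

Definition OTS_BST (w : word) : Prop :=
  exists F k, w = encode F k /\ exists T, is_BST F T /\ tsize T <= k.
Definition OTS_DST (w : word) : Prop :=
  exists F k, w = encode F k /\ exists T, is_DST F T /\ tsize T <= k.

(* cobham n f : f is an n-ary polynomial-time computable word function
   (arguments given as a list of length n). *)
Inductive cobham : nat -> (seq word -> word) -> Prop :=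
| cb_nil n : cobham n (fun _ => [::])
| cb_proj n i : i < n -> cobham n (fun xs => nth [::] xs i)
| cb_succ (b : bool) : cobham 1 (fun xs => b :: nth [::] xs 0)
| cb_smash : cobham 2 (fun xs =>
     nseq (size (nth [::] xs 0) * size (nth [::] xs 1)) false)
| cb_comp n m (g : seq word -> word) (hs : nat -> seq word -> word) :
    cobham m g -> (forall i, i < m -> cobham n (hs i)) ->
    cobham n (fun xs => g [seq hs i xs | i <- iota 0 m])
| cb_rec n (g : seq word -> word) (h0 h1 : seq word -> word)
    (k : seq word -> word) (f : seq word -> word) :
    cobham n g -> cobham n.+2 h0 -> cobham n.+2 h1 -> cobham n.+1 k ->
    (forall xs, size xs = n -> f (rcons xs [::]) = g xs) ->
    (forall xs y (b : bool), size xs = n ->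
        f (rcons xs (b :: y)) =
        (if b then h1 else h0) (rcons (rcons xs y) (f (rcons xs y)))) ->
    (forall xs y, size xs = n -> size (f (rcons xs y)) <= size (k (rcons xs y))) ->
    cobham n.+1 f
| cb_ext n (f f' : seq word -> word) :
    cobham n f -> (forall xs, size xs = n -> f xs = f' xs) -> cobham n f'.

Definition in_NP (L : word -> Prop) : Prop :=
  exists (R : seq word -> word) (c : nat), cobham 2 R /\
    forall x, L x <-> exists y : word,
      size y <= c * (size x) ^ c + c /\ R [:: x; y] = [:: true].

Definition in_coNP (L : word -> Prop) : Prop :=
  exists L', in_NP L' /\ forall x, L x <-> ~ L' x.

Definition poly_reduces (L L' : word -> Prop) : Prop :=
  exists f : seq word -> word, cobham 1 f /\ forall x, L x <-> L' (f [:: x]).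

Definition coNP_hard (L' : word -> Prop) : Prop :=
  forall L, in_coNP L -> poly_reduces L L'.

(* Main.v *)
Require Import Defs.
From mathcomp Require Import all_boot.
Set Implicit Arguments. Unset Strict Implicit. Unset Printing Implicit Defensive.

(* A search tree of either kind certifies unsatisfiability, and an unsatisfiable
   formula F has one with fewer than 2^n nodes, where n bounds the number of its
   variables.  Hence F is unsatisfiable iff (F, 2^n - 1) is in OTS, and 2^n - 1 is
   just a run of ones in binary.  It remains to reduce NP to SAT inside Cobham's
   algebra.  By induction on a Cobham function f one builds, for each width B, a
   CNF which forces a word variable to hold f xs when the input word variables
   hold xs: composition and recursion on notation become conjunctions of copies
   of the formulas of the components, one copy per suffix of the recursion
   argument.  Word variables are named by words, and the auxiliary names of a
   copy extend a private prefix.  A propositional variable is the number whose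
   binary expansion is essentially such a name, so writing the formula down is
   mere concatenation of words in nested loops. *)

(** * Programming in Cobham's algebra *)

(** Maps into argument lists, so that arguments can be rearranged by [cons], [rcons], [take] and
    [behead] before a composition, instead of being given as an indexed family. *)
Definition clist (n m : nat) (L : seq word -> seq word) : Prop :=
  (forall xs, size xs = n -> size (L xs) = m) /\
  (forall i, i < m -> cobham n (fun xs => nth [::] (L xs) i)).

Lemma cob_comp n m g L :
  cobham m g -> clist n m L -> cobham n (fun xs => g (L xs)).
Proof.
move=> Cg [sL CL]; have := cb_comp Cg CL; move/cb_ext; apply=> xs sxs.
by rewrite -{2}(mkseq_nth [::] (L xs)) sL.
Qed.

Lemma clist_nil n : clist n 0 (fun=> [::]).
Proof. by []. Qed.

Lemma clist_cons n m f L :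
  cobham n f -> clist n m L -> clist n m.+1 (fun xs => f xs :: L xs).
Proof.
move=> Cf [sL CL]; split=> [xs /sL /= -> //|[|i] //= lim]; exact: CL.
Qed.

Lemma clist_rcons n m f L :
  cobham n f -> clist n m L -> clist n m.+1 (fun xs => rcons (L xs) (f xs)).
Proof.
move=> Cf [sL CL]; split=> [xs /sL e|i]; first by rewrite size_rcons e.
rewrite ltnS leq_eqVlt => /orP[/eqP ->|lim].
  by apply: cb_ext Cf _ => xs /sL e; rewrite nth_rcons e ltnn eqxx.
by apply: cb_ext (CL _ lim) _ => xs /sL e; rewrite nth_rcons e lim.
Qed.

Lemma clist_id n : clist n n id.
Proof. by split=> // i lin; apply: cb_proj. Qed.

Lemma clist_behead n : clist n.+1 n behead.
Proof.
split=> [xs|i lin]; first by rewrite size_behead => ->.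
by apply: cb_ext (cb_proj (lin : i.+1 < n.+1)) _ => xs _; rewrite nth_behead.
Qed.

Lemma clist_take n k : clist (n + k) n (take n).
Proof.
split=> [xs sxs|i lin]; first by rewrite size_takel // sxs leq_addr.
apply: cb_ext (cb_proj (leq_trans lin (leq_addr k n))) _ => xs _.
by rewrite nth_take.
Qed.

Lemma clist_comp n m k L M :
  clist m k L -> clist n m M -> clist n k (fun xs => L (M xs)).
Proof.
move=> [sL CL] CM; split=> [xs /CM.1 /sL //|i lik].
exact: (cob_comp (CL _ lik) CM).
Qed.

Lemma clist_mkseq n m (h : nat -> seq word -> word) :
  (forall i, i < m -> cobham n (h i)) ->
  clist n m (fun xs => [seq h i xs | i <- iota 0 m]).
Proof.
move=> Ch; split=> [xs _|i lim]; first by rewrite size_map size_iota.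
apply: cb_ext (Ch _ lim) _ => xs _.
by rewrite (nth_map 0) ?size_iota // nth_iota.
Qed.

Lemma cob_wk n f : cobham n f -> cobham n.+1 (fun zs => f (behead zs)).
Proof. by move=> Cf; apply: cob_comp Cf (clist_behead n). Qed.

Lemma clist_wk n m L : clist n m L -> clist n.+1 m (fun zs => L (behead zs)).
Proof. by move=> CL; apply: clist_comp CL (clist_behead n). Qed.

Lemma cob_head n : cobham n.+1 (head [::]).
Proof. by apply: cb_ext (cb_proj (ltn0Sn n)) _ => -[]. Qed.

Lemma cob_cons n b f : cobham n f -> cobham n (fun xs => b :: f xs).
Proof. by move=> Cf; apply: (cob_comp (cb_succ b) (clist_cons Cf (clist_nil n))). Qed.

Lemma cob_const n w : cobham n (fun=> w).
Proof. elim: w => [|b w IH]; [exact: cb_nil | exact: cob_cons]. Qed.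

Lemma cob_smash n f g : cobham n f -> cobham n g ->
  cobham n (fun xs => nseq (size (f xs) * size (g xs)) false).
Proof.
move=> Cf Cg.
exact: (cob_comp cb_smash (clist_cons Cf (clist_cons Cg (clist_nil n)))).
Qed.

Fixpoint wrec (g : word) (h : bool -> word -> word -> word) (y : word) : word :=
  if y is b :: y' then h b y' (wrec g h y') else g.

(** Convenient form of [cb_rec]: the recursion argument is any Cobham function [Y], and recursive
    value and suffix precede the parameters, so that a step reads them by [head] and [behead]. *)
Lemma cob_wrec n g (h : bool -> seq word -> word -> word -> word) k Y :
  cobham n g ->
  (forall b, cobham n.+2 (fun zs =>
     h b (behead (behead zs)) (head [::] (behead zs)) (head [::] zs))) ->
  cobham n.+1 k -> cobham n Y ->
  (forall xs y, size xs = n ->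
     size (wrec (g xs) (fun b => h b xs) y) <= size (k (y :: xs))) ->
  cobham n (fun xs => wrec (g xs) (fun b => h b xs) (Y xs)).
Proof.
move=> Cg Ch Ck CY bnd.
have tk xs y : size xs = n -> take n (rcons xs y) = xs.
  by move=> <-; rewrite -cats1 take_size_cat.
pose hh b zs := h b (take n zs) (nth [::] zs n) (nth [::] zs n.+1).
have Chh b : cobham n.+2 (hh b).
  apply: (@cob_comp _ n.+2 _ (fun zs => [:: nth [::] zs n.+1, nth [::] zs n & take n zs]) (Ch b)).
  by do 2!(apply: clist_cons; first exact: cb_proj); rewrite -addn2; exact: clist_take.
have Ckk : cobham n.+1 (fun zs => k (nth [::] zs n :: take n zs)).
  apply: cob_comp Ck _; apply: clist_cons; first exact: cb_proj.
  by rewrite -addn1; exact: clist_take.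
pose ff zs := wrec (g (take n zs)) (fun b => h b (take n zs)) (nth [::] zs n).
have Cff : cobham n.+1 ff.
  apply: (cb_rec Cg (Chh false) (Chh true) Ckk).
  - by move=> xs sxs; rewrite /ff tk // nth_rcons sxs ltnn eqxx.
  - move=> xs y b sxs; rewrite /ff !tk // !nth_rcons sxs ltnn eqxx /=.
    rewrite -[RHS]/((if b then hh true else hh false) _).
    suff -> : (if b then hh true else hh false) = hh b.
      rewrite /hh !nth_rcons !size_rcons !sxs ltnn eqxx ltnSn ltnn eqxx.
      by rewrite -2!cats1 -catA take_size_cat.
    by case: b.
  - by move=> xs y sxs; rewrite /ff !tk // !nth_rcons sxs ltnn eqxx; apply: bnd.
apply: cb_ext (cob_comp Cff (clist_rcons CY (clist_id n))) _ => xs sxs.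
by rewrite /ff tk // nth_rcons sxs ltnn eqxx.
Qed.

Lemma cob_cat n f g :
  cobham n f -> cobham n g -> cobham n (fun xs => f xs ++ g xs).
Proof.
move=> Cf Cg.
have E x y : wrec x (fun b _ r => b :: r) y = y ++ x by elim: y => //= b y ->.
(* The product of the two lengths, each increased by one, dominates their sum, so smash supplies the
   bound that recursion demands. *)
have bnd xs y : size xs = n -> size (wrec (g xs) (fun b _ r => b :: r) y) <=
    size (nseq (size (false :: g xs) * size (false :: y)) false).
  move=> _; rewrite E size_cat size_nseq /= mulSn mulnS addSn leqW //.
  by rewrite addnA leq_addr.
have Ck : cobham n.+1 (fun zs => nseq (size (false :: g (behead zs))
    * size (false :: head [::] zs)) false).
  by apply: cob_smash; apply: cob_cons; [apply: cob_wk | apply: cob_head].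
have := @cob_wrec n g (fun b _ _ r => b :: r) _ f Cg
  (fun b => cob_cons b (cob_head _)) Ck Cf bnd.
by move/cb_ext; apply=> xs _; rewrite E.
Qed.

(** * Unary numbers and polynomial growth *)

Definition cobN n (N : seq word -> nat) := cobham n (fun xs => nseq (N xs) false).

Lemma cobN_const n k : cobN n (fun=> k).
Proof. exact: cob_const. Qed.

Lemma cobN_size n f : cobham n f -> cobN n (fun xs => size (f xs)).
Proof.
move=> Cf; apply: cb_ext (cob_smash Cf (cob_const n [:: false])) _ => xs _.
by rewrite muln1.
Qed.

Lemma cobN_S n N : cobN n N -> cobN n (fun xs => (N xs).+1).
Proof. exact: cob_cons. Qed.

Lemma cobN_add n M N : cobN n M -> cobN n N -> cobN n (fun xs => M xs + N xs).
Proof. by move=> CM CN; apply: cb_ext (cob_cat CM CN) _ => xs _; rewrite nseqD. Qed.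

Lemma cobN_mul n M N : cobN n M -> cobN n N -> cobN n (fun xs => M xs * N xs).
Proof. by move=> CM CN; apply: cb_ext (cob_smash CM CN) _ => xs _; rewrite !size_nseq. Qed.

Lemma cobN_exp n N c : cobN n N -> cobN n (fun xs => N xs ^ c).
Proof.
move=> CN; elim: c => [|c IH]; first exact: cobN_const.
by apply: cb_ext (cobN_mul CN IH) _ => xs _; rewrite expnS.
Qed.

Definition ssz (xs : seq word) : nat := sumn [seq size x | x <- xs].

Lemma cobN_ssz n : cobN n ssz.
Proof.
elim: n => [|n IH]; first by apply: cb_ext (cob_const 0 [::]) _ => -[].
apply: cb_ext (cobN_add (cobN_size (cob_head n)) (cob_wk IH)) _.
by case.
Qed.

(* A one-parameter cofinal family of polynomials. *)
Definition pol (c s : nat) : nat := (s + c).+1 ^ c.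

Lemma cobN_pol n c N : cobN n N -> cobN n (fun xs => pol c (N xs)).
Proof. by move=> CN; apply/cobN_exp/cobN_S/cobN_add/cobN_const. Qed.

Lemma leq_wexp2r m n e : m <= n -> m ^ e <= n ^ e.
Proof. by case: e => // e; rewrite leq_exp2r. Qed.

Lemma pol_mono c c' s s' : c <= c' -> s <= s' -> pol c s <= pol c' s'.
Proof.
move=> lec les; apply: leq_trans (leq_pexp2l (ltn0Sn _) lec).
by apply: leq_wexp2r; rewrite // ltnS leq_add.
Qed.

Lemma leq_pol c s : 0 < c -> s <= pol c s.
Proof.
move=> c0; apply: leq_trans (leq_pexp2l (ltn0Sn _) c0).
by rewrite expn1 leqW // leq_addr.
Qed.

Lemma pol_mul a b s : pol a s * pol b s <= pol (a + b) s.
Proof.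
rewrite /pol expnD leq_mul // leq_wexp2r // ltnS leq_add2l ?leq_addr ?leq_addl //.
Qed.

Lemma pol_add a b s : pol a s + pol b s <= pol (a + b).+1 s.
Proof.
have X2 : 2 <= (s + (a + b).+1).+1 by rewrite addnS.
rewrite /pol expnS (leq_trans _ (leq_mul X2 (leqnn _))) // mul2n -addnn.
have le d : d <= a + b -> (s + d).+1 ^ d <= (s + (a + b).+1).+1 ^ (a + b).
  move=> led; apply: leq_trans (leq_pexp2l (ltn0Sn _) led); apply: leq_wexp2r => //.
  by rewrite ltnS leq_add2l leqW.
by rewrite leq_add // le // ?leq_addr ?leq_addl.
Qed.

Lemma pol_comp d c s : pol d (pol c s) <= pol (c.+1 * d + c + d).+1 s.
Proof.
(* [b] dominates every base involved: the inner polynomial plus [d + 1] is at most [b ^ c.+1], and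
   [b <= s + e + 1]. *)
set e := (_).+1; pose b := (s + c + d).+2.
have le1 : (pol c s + d).+1 <= b ^ c.+1.
  have le2 : pol c s <= b ^ c by apply: leq_wexp2r => //; rewrite ltnS leqW // leq_addr.
  rewrite expnS mulSn -addnS leq_add //.
  rewrite -[d.+1]muln1 leq_mul ?expn_gt0 //.
  by rewrite ltnS leq_addl.
have le3 : b <= (s + e).+1 by rewrite /b /e ltnS addnS ltnS -addnA leq_add2l -addnA leq_addl.
apply: (@leq_trans (b ^ (c.+1 * d))); first by rewrite expnM leq_wexp2r.
apply: leq_trans (leq_pexp2l (ltn0Sn _) (_ : c.+1 * d <= e)); first exact: leq_wexp2r.
by rewrite /e leqW // -addnA leq_addr.
Qed.

Lemma ssz_rcons xs x : ssz (rcons xs x) = ssz xs + size x.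
Proof. by rewrite /ssz map_rcons sumn_rcons. Qed.

Lemma size_nth_ssz xs i : size (nth [::] xs i) <= ssz xs.
Proof.
elim: xs i => [|x xs IH] [|i] //=; first by rewrite leq_addr.
by rewrite (leq_trans (IH i)) // leq_addl.
Qed.

Lemma ssz_map_bound (hs : nat -> seq word -> word) (c : nat -> nat) n m xs :
  size xs = n ->
  (forall i, i < m -> forall xs, size xs = n -> size (hs i xs) <= pol (c i) (ssz xs)) ->
  ssz [seq hs i xs | i <- iota 0 m] <= pol (\sum_(i < m) (c i).+1) (ssz xs).
Proof.
move=> sxs; elim: m => [|m IH] H //.
rewrite -addn1 iotaD map_cat cats1 ssz_rcons addn1 big_ord_recr /= addnS.
apply: leq_trans (pol_add _ _ _); apply: leq_add; last exact: H.
by apply: IH => i lim; apply: H; apply: leqW.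
Qed.

(** Finite choice by induction, with no choice axiom; it collects the bounds and the compiled data
    of the components of a composition. *)
Lemma fin_choice (A : Type) (P : nat -> A -> Prop) (a0 : A) m :
  (forall i, i < m -> exists a, P i a) ->
  exists F : nat -> A, forall i, i < m -> P i (F i).
Proof.
elim: m => [|m IH] H; first by exists (fun=> a0).
have [F HF] := IH (fun i lim => H i (leqW lim)); have [a Ha] := H m (leqnn _).
exists (fun i => if i == m then a else F i) => i; rewrite ltnS leq_eqVlt.
by have [-> //|_ /=] := eqVneq i m; apply: HF.
Qed.

(** Every constructor preserves polynomial growth; recursion does so because its length is dominated
    by that of the bounding function [k]. *)
Lemma cobham_size n f : cobham n f ->
  exists c, forall xs, size xs = n -> size (f xs) <= pol c (ssz xs).
Proof.
elim=> {n f}.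
- by exists 0.
- move=> n i lin; exists 1 => xs _; apply: leq_trans (leq_pol _ _) => //.
  exact: size_nth_ssz.
- move=> b; exists 1 => -[|x []] //= _; rewrite /ssz /pol /= addn0 addn1 expn1.
  by rewrite leqW.
- exists 2 => xs _; rewrite size_nseq; apply: leq_trans (pol_mul 1 1 _).
  by rewrite leq_mul // (leq_trans (size_nth_ssz _ _)) // leq_pol.
- move=> n m g hs _ [cg Hg] _ /(fin_choice 0)[c Hc].
  eexists => xs sxs; apply: leq_trans (pol_comp cg _ _).
  apply: leq_trans (Hg _ _) _; first by rewrite size_map size_iota.
  by apply: pol_mono => //; apply: ssz_map_bound sxs Hc.
- move=> n g h0 h1 k f _ _ _ _ _ _ _ [c Hc] _ _ bnd; exists c => xs.
  case/lastP: xs => // xs y; rewrite size_rcons => -[sxs].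
  by apply: leq_trans (bnd _ _ sxs) (Hc _ _); rewrite size_rcons sxs.
- by move=> n f f' _ [c Hc] e; exists c => xs sxs; rewrite -e // Hc.
Qed.

(** * Loops that concatenate words *)

Fixpoint catloop (G : bool -> word -> word) (y : word) : word :=
  if y is b :: y' then G b y' ++ catloop G y' else [::].

(** Each pass sees a suffix of [Y], so one polynomial bounds the output of all passes, and the whole
    is at most [size y] times that; this is the bound that recursion asks for. *)
Lemma cob_catloop n (G : bool -> seq word -> word -> word) Y :
  (forall b, cobham n.+1 (fun zs => G b (behead zs) (head [::] zs))) ->
  cobham n Y ->
  cobham n (fun xs => catloop (fun b => G b xs) (Y xs)).
Proof.
move=> CG CY; have [c0 Hc0] := cobham_size (CG false); have [c1 Hc1] := cobham_size (CG true).
have E xs y : wrec [::] (fun b y' r => G b xs y' ++ r) y = catloop (fun b => G b xs) y.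
  by elim: y => //= b y ->.
have bnd xs y : size xs = n ->
    size (catloop (fun b => G b xs) y) <= size y * pol (c0 + c1) (ssz (y :: xs)).
  move=> sxs; elim: y => //= b y IH; rewrite size_cat mulSn leq_add //.
    have le : ssz (y :: xs) <= ssz ((b :: y) :: xs) by exact: leqnSn.
    case: b IH le => _ le.
      apply: leq_trans (Hc1 (y :: xs) (congr1 S sxs)) _.
      by apply: pol_mono => //; rewrite leq_addl.
    apply: leq_trans (Hc0 (y :: xs) (congr1 S sxs)) _.
    by apply: pol_mono => //; rewrite leq_addr.
  apply: leq_trans IH _; rewrite leq_mul2l pol_mono ?orbT //.
have Ck : cobN n.+1 (fun zs => size (head [::] zs) * pol (c0 + c1) (ssz zs)).
  apply: cobN_mul; first exact/cobN_size/cob_head.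
  exact/cobN_pol/cobN_ssz.
have Ch b : cobham n.+2 (fun zs =>
    G b (behead (behead zs)) (head [::] (behead zs)) ++ head [::] zs).
  by apply: cob_cat; [exact: cob_wk (CG b) | exact: cob_head].
have H := @cob_wrec n (fun=> [::]) (fun b xs y r => G b xs y ++ r) _ Y (cb_nil n) Ch Ck CY.
apply: cb_ext (H _) _ => [xs y sxs|xs _]; last by rewrite E.
by rewrite E size_nseq; apply: bnd.
Qed.

Definition hom (w : bool -> word) (y : word) : word := flatten [seq w b | b <- y].

Lemma cob_hom n w f : cobham n f -> cobham n (fun xs => hom w (f xs)).
Proof.
move=> Cf.
have := @cob_catloop n (fun b _ _ => w b) f (fun b => cob_const _ _) Cf.
by move/cb_ext; apply=> xs _; rewrite /hom; elim: (f xs) => //= b y ->.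
Qed.

(* Locked, so that unification never unfolds a loop into a concatenation. *)
Fact loop_key : unit. Proof. exact: tt. Qed.
Definition loop (T : Type) (k : nat) (G : nat -> seq T) : seq T :=
  locked_with loop_key (flatten [seq G i | i <- iota 0 k]).

Lemma loop0 T (G : nat -> seq T) : loop 0 G = [::].
Proof. by rewrite /loop locked_withE. Qed.

Lemma loopS T k (G : nat -> seq T) : loop k.+1 G = loop k G ++ G k.
Proof.
by rewrite /loop !locked_withE -addn1 iotaD map_cat flatten_cat /= cats0.
Qed.

Lemma wrec_loop (G : nat -> word) y :
  wrec [::] (fun _ y' r => r ++ G (size y')) y = loop (size y) G.
Proof. by elim: y => [|b y /= ->]; rewrite ?loop0 ?loopS. Qed.

Lemma cob_loop n (G : seq word -> nat -> word) N :
  cobham n.+1 (fun zs => G (behead zs) (size (head [::] zs))) ->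
  cobN n N ->
  cobham n (fun xs => loop (N xs) (G xs)).
Proof.
move=> CG CN; have [c Hc] := cobham_size CG.
have bnd xs y : size xs = n ->
    size (loop (size y) (G xs)) <= size y * pol c (ssz (y :: xs)).
  move=> sxs; elim: y => [|b y IH]; rewrite /= ?loop0 ?loopS // size_cat mulSn addnC.
  have le : ssz (y :: xs) <= ssz ((b :: y) :: xs) by exact: leqnSn.
  rewrite leq_add //.
    by apply: leq_trans (Hc (y :: xs) (congr1 S sxs)) _; apply: pol_mono.
  by apply: leq_trans IH _; rewrite leq_mul2l pol_mono ?orbT.
have Ck : cobN n.+1 (fun zs => size (head [::] zs) * pol c (ssz zs)).
  apply: cobN_mul; first exact/cobN_size/cob_head.
  exact/cobN_pol/cobN_ssz.
have Ch (b : bool) : cobham n.+2 (fun zs =>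
    head [::] zs ++ G (behead (behead zs)) (size (head [::] (behead zs)))).
  by apply: cob_cat; [exact: cob_head | exact: cob_wk CG].
have H := @cob_wrec n (fun=> [::]) (fun b xs y r => r ++ G xs (size y)) _ _ (cb_nil n) Ch Ck CN.
apply: cb_ext (H _) _ => [xs y sxs|xs _]; last by rewrite wrec_loop size_nseq.
by rewrite wrec_loop size_nseq; apply: bnd.
Qed.

(** * Word variables and gates *)

Definition encs (F : cnf) : word := flatten [seq enc_clause C | C <- F].

(** The closing markers [ENDc] here and [SEP] in [cobF] are left out, so that adding literals or
    clauses is concatenation of words. *)
Definition cobC n (C : seq word -> clause) :=
  cobham n (fun xs => flatten [seq enc_lit l | l <- C xs]).

Definition cobF n (F : seq word -> cnf) := cobham n (fun xs => encs (F xs)).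

(* The number whose binary expansion is w followed by the top bit 1: any word
   can thus name a propositional variable. *)
Definition code (w : word) : nat := foldr (fun (b : bool) n => b + n.*2) 1 w.

Lemma code_gt0 w : 0 < code w.
Proof. by elim: w => //= b w IH; rewrite addn_gt0 double_gt0 IH orbT. Qed.

Lemma binary_code w : binary (code w) = rcons w true.
Proof.
suff H k : code w <= k -> bits_aux k (code w) = rcons w true by exact: H.
elim: w k => [|b w IH] [|k] //=; first by case: k.
  by rewrite leqNgt addn_gt0 double_gt0 code_gt0 orbT.
move=> le; have c0 := code_gt0 w; rewrite addn_eq0 double_eq0.
rewrite -[code w == 0]negbK -lt0n c0 andbF oddD odd_double addbF oddb half_bit_double.
rewrite IH // -ltnS; apply: leq_trans le.
by rewrite -addnn addnA -{1}[code w]add0n ltn_add2r addn_gt0 c0 orbT.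
Qed.

(** Meant to be true when position [i] of the word named [v] exists and carries the bit [c]; if both
    variables of a position are false, the word has ended. The index stands in unary, and its
    closing [true] makes the name decodable. *)
Definition var (v : word) (i : nat) (c : bool) : nat :=
  code (c :: nseq i false ++ true :: v).

Definition plit (v : word) (i : nat) (c : bool) : lit := (var v i c, true).
Definition nlit (v : word) (i : nat) (c : bool) : lit := (var v i c, false).

Lemma cob_lit n v N c p : cobham n v -> cobN n N ->
  cobham n (fun xs => enc_lit (var (v xs) (N xs) c, p)).
Proof.
move=> Cv CN; apply: cob_cat; first exact: cob_const.
apply: cob_cat; last exact: cob_const.
have H : cobham n (fun xs => c :: nseq (N xs) false ++ true :: v xs ++ [:: true]).
  apply/cob_cons/cob_cat => //; apply/cob_cons/cob_cat => //; exact: cob_const.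
apply: cb_ext (cob_hom enc_bit H) _ => xs _.
by rewrite /enc_nat binary_code /hom /= rcons_cat /= cats1.
Qed.

Lemma cobC_nil n : cobC n (fun=> [::]).
Proof. exact: cob_const. Qed.

Lemma cobC_pos n v N c C : cobham n v -> cobN n N -> cobC n C ->
  cobC n (fun xs => plit (v xs) (N xs) c :: C xs).
Proof. by move=> Cv CN CC; apply: cob_cat CC; apply: cob_lit. Qed.

Lemma cobC_neg n v N c C : cobham n v -> cobN n N -> cobC n C ->
  cobC n (fun xs => nlit (v xs) (N xs) c :: C xs).
Proof. by move=> Cv CN CC; apply: cob_cat CC; apply: cob_lit. Qed.

Lemma cobF_nil n : cobF n (fun=> [::]).
Proof. exact: cob_const. Qed.

Lemma cobF_cons n C F : cobC n C -> cobF n F -> cobF n (fun xs => C xs :: F xs).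
Proof. by move=> CC CF; apply: cob_cat CF; apply: cob_cat CC _; apply: cob_const. Qed.

Lemma encs_cat F G : encs (F ++ G) = encs F ++ encs G.
Proof. by rewrite /encs map_cat flatten_cat. Qed.

Lemma cobF_cat n F G : cobF n F -> cobF n G -> cobF n (fun xs => F xs ++ G xs).
Proof. by move=> CF CG; apply: cb_ext (cob_cat CF CG) _ => xs _; rewrite encs_cat. Qed.

Lemma encs_loop k (G : nat -> cnf) : encs (loop k G) = loop k (fun i => encs (G i)).
Proof. by elim: k => [|k IH]; rewrite ?loop0 // !loopS encs_cat IH. Qed.

Lemma cobF_loop n (G : seq word -> nat -> cnf) N :
  cobF n.+1 (fun zs => G (behead zs) (size (head [::] zs))) ->
  cobN n N -> cobF n (fun xs => loop (N xs) (G xs)).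
Proof.
move=> CG CN; have H := @cob_loop n (fun xs i => encs (G xs i)) N CG CN.
by apply: cb_ext H _ => xs _; rewrite encs_loop.
Qed.

(** * Satisfaction and represented words *)

Definition slit (al : nat -> bool) (l : lit) : bool := al l.1 == l.2.
Definition sat (al : nat -> bool) (F : cnf) : bool := all (has (slit al)) F.

Lemma sat_cat al F G : sat al (F ++ G) = sat al F && sat al G.
Proof. exact: all_cat. Qed.

Lemma sat_loop al k G : sat al (loop k G) <-> forall i, i < k -> sat al (G i).
Proof.
elim: k => [|k IH]; first by rewrite loop0.
rewrite loopS sat_cat; split=> [/andP[/IH H1 H2] i|H].
  by rewrite ltnS leq_eqVlt => /orP[/eqP -> //|]; apply: H1.
by rewrite H // andbT; apply/IH => i /leqW; apply: H.
Qed.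

Definition wbit (w : word) (i : nat) (c : bool) : bool :=
  (i < size w) && (nth false w i == c).

(** Position [B] is included, always past the end, so that a shift can read the position after the
    last bit. *)
Definition rep (B : nat) (al : nat -> bool) (v w : word) : Prop :=
  size w <= B /\ forall i c, i <= B -> al (var v i c) = wbit w i c.

Lemma wbit_behead w i c : wbit (behead w) i c = wbit w i.+1 c.
Proof. by case: w. Qed.

Lemma wbit_over w i c : size w <= i -> wbit w i c = false.
Proof. by rewrite /wbit leqNgt => /negbTE ->. Qed.

(** The assignment induced by an interpretation [rho] of names: [n] is decoded into bit, index and
    name, and [(size v).-1] drops the top bit that [code] added. *)
Definition asg (rho : word -> word) (n : nat) : bool :=
  if binary n is c :: r then
    let i := index true r in
    let v := drop i.+1 r in
    wbit (rho (take (size v).-1 v)) i c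
  else false.

Lemma index_tag i v : index true (nseq i false ++ true :: v) = i.
Proof. by elim: i => //= i ->. Qed.

Lemma drop_tag i v : drop i.+1 (nseq i false ++ true :: v) = v.
Proof. by elim: i => //=; rewrite drop0. Qed.

Lemma asg_var rho v i c : asg rho (var v i c) = wbit (rho v) i c.
Proof.
rewrite /asg binary_code /= rcons_cat /= index_tag drop_tag size_rcons /=.
by rewrite -cats1 take_size_cat.
Qed.

(** [g] is a guard: the two positions must agree unless one of its literals holds. *)
Definition eqF (g : clause) (o : word) (i : nat) (a : word) (j : nat) : cnf :=
  [:: [:: nlit o i true, plit a j true & g]; [:: plit o i true, nlit a j true & g];
      [:: nlit o i false, plit a j false & g]; [:: plit o i false, nlit a j false & g]].

Lemma sat_eqF al g o i a j : sat al (eqF g o i a j) <->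
  has (slit al) g \/ forall c, al (var o i c) = al (var a j c).
Proof.
have -> : sat al (eqF g o i a j) = has (slit al) g ||
    ((al (var o i true) == al (var a j true)) && (al (var o i false) == al (var a j false))).
  rewrite /sat /= /slit /=; case: (has _ g); rewrite ?orbT //= ?orbF.
  by do 4!case: (al _).
split=> [/orP[->|/andP[/eqP e1 /eqP e2]]|[->//|H]]; [by left|right; by case|].
by rewrite !H !eqxx orbT.
Qed.

Lemma cobF_eqF n g o i a j : cobC n g -> cobham n o -> cobN n i -> cobham n a -> cobN n j ->
  cobF n (fun xs => eqF (g xs) (o xs) (i xs) (a xs) (j xs)).
Proof.
move=> Cg Co Ci Ca Cj; do 4!(apply: cobF_cons; first
  by [apply: cobC_neg => //; apply: cobC_pos | apply: cobC_pos => //; apply: cobC_neg]).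
exact: cobF_nil.
Qed.

Definition noneF (v : word) (i : nat) : cnf := [:: [:: nlit v i true]; [:: nlit v i false]].

Lemma sat_noneF al v i : sat al (noneF v i) <-> forall c, al (var v i c) = false.
Proof.
rewrite /sat /= /slit /= !eqbF_neg !orbF andbT; split=> [/andP[h1 h2] []|H]; rewrite ?H //.
  by apply/negbTE.
by apply/negbTE.
Qed.

Lemma cobF_noneF n v N : cobham n v -> cobN n N -> cobF n (fun xs => noneF (v xs) (N xs)).
Proof.
move=> Cv CN; do 2!(apply: cobF_cons; first by apply: cobC_neg => //; apply: cobC_nil).
exact: cobF_nil.
Qed.

Definition nilF (B : nat) (o : word) : cnf := loop B.+1 (noneF o).

Definition consF (b : bool) (B : nat) (o a : word) : cnf :=
  [:: [:: plit o 0 b]; [:: nlit o 0 (~~ b)]] ++ loop B (fun i => eqF [::] o i.+1 a i).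

(** Position [B] of the result would be read from position [B.+1], outside the range of [rep], so it
    is declared empty. *)
Definition tailF (B : nat) (o a : word) : cnf :=
  noneF o B ++ loop B (fun i => eqF [::] o i a i.+1).

(** The guards select on the start of [y]: each is false exactly in its own case (bit [true], bit
    [false], empty word), and only then is copying enforced. *)
Definition muxF (B : nat) (o y a b0 b1 : word) : cnf :=
  loop B.+1 (fun i => eqF [:: nlit y 0 true] o i b1 i ++
    (eqF [:: nlit y 0 false] o i b0 i ++
     eqF [:: plit y 0 true; plit y 0 false] o i a i)).

Definition mux (y a b0 b1 : word) : word :=
  if y is b :: _ then if b then b1 else b0 else a.

Section Gates.
Variables (n : nat) (B : seq word -> nat) (CB : cobN n B).

Let CI : cobN n.+1 (fun zs => size (head [::] zs)).
Proof. exact/cobN_size/cob_head. Qed.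

Lemma cobF_nilF o : cobham n o -> cobF n (fun xs => nilF (B xs) (o xs)).
Proof.
move=> Co; apply: (@cobF_loop n (fun xs i => noneF (o xs) i)); last exact: cobN_S.
by apply: cobF_noneF => //; apply: cob_wk.
Qed.

Lemma cobF_consF b o a : cobham n o -> cobham n a ->
  cobF n (fun xs => consF b (B xs) (o xs) (a xs)).
Proof.
move=> Co Ca; apply: cobF_cat.
  apply: cobF_cons; first by apply: cobC_pos => //; [apply: cobN_const | apply: cobC_nil].
  apply: cobF_cons; first by apply: cobC_neg => //; [apply: cobN_const | apply: cobC_nil].
  exact: cobF_nil.
apply: (@cobF_loop n (fun xs i => eqF [::] (o xs) i.+1 (a xs) i)) => //.
by apply: cobF_eqF; [apply: cobC_nil | apply: cob_wk | apply: cobN_S | apply: cob_wk | ].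
Qed.

Lemma cobF_tailF o a : cobham n o -> cobham n a ->
  cobF n (fun xs => tailF (B xs) (o xs) (a xs)).
Proof.
move=> Co Ca; apply: cobF_cat; first exact: cobF_noneF.
apply: (@cobF_loop n (fun xs i => eqF [::] (o xs) i (a xs) i.+1)) => //.
by apply: cobF_eqF; [apply: cobC_nil | apply: cob_wk | | apply: cob_wk | apply: cobN_S ].
Qed.

Lemma cobF_muxF o y a b0 b1 :
  cobham n o -> cobham n y -> cobham n a -> cobham n b0 -> cobham n b1 ->
  cobF n (fun xs => muxF (B xs) (o xs) (y xs) (a xs) (b0 xs) (b1 xs)).
Proof.
move=> Co Cy Ca C0 C1.
apply: (@cobF_loop n (fun xs i => eqF [:: nlit (y xs) 0 true] (o xs) i (b1 xs) i ++
    (eqF [:: nlit (y xs) 0 false] (o xs) i (b0 xs) i ++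
     eqF [:: plit (y xs) 0 true; plit (y xs) 0 false] (o xs) i (a xs) i))); last exact: cobN_S.
have Cy' := cob_wk Cy; have Z := cobN_const n.+1 0.
apply: cobF_cat; [|apply: cobF_cat]; apply: cobF_eqF => //; try exact: cob_wk.
- by apply: cobC_neg => //; apply: cobC_nil.
- by apply: cobC_neg => //; apply: cobC_nil.
- by do 2!apply: cobC_pos => //; apply: cobC_nil.
Qed.

End Gates.

Section Soundness.
Variables (B : nat) (al : nat -> bool).

Lemma nilF_sound o : sat al (nilF B o) -> rep B al o [::].
Proof.
by move=> /sat_loop H; split=> // i c le; have /sat_noneF -> := H i le.
Qed.

Lemma consF_sound b o a w : size w < B -> sat al (consF b B o a) ->
  rep B al a w -> rep B al o (b :: w).
Proof.
move=> sw; rewrite sat_cat => /andP[H0 /sat_loop H1] [_ Ha]; split=> // -[|i] c le.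
  move: H0; rewrite /sat /= /slit /= !orbF andbT => /andP[/eqP e1 /eqP e2].
  by rewrite /wbit /=; case: (eqVneq b c) => [<- //|]; case: b c e1 e2 => [] [].
by have /sat_eqF[//|->] := H1 i le; rewrite Ha // ltnW.
Qed.

Lemma tailF_sound o a w : sat al (tailF B o a) ->
  rep B al a w -> rep B al o (behead w).
Proof.
rewrite sat_cat => /andP[/sat_noneF H0 /sat_loop H1] [sw Ha].
split=> [|i c]; first by rewrite size_behead (leq_trans (leq_pred _)).
rewrite leq_eqVlt => /orP[/eqP ->|le].
  by rewrite H0 wbit_over // size_behead (leq_trans (leq_pred _)).
by have /sat_eqF[//|->] := H1 i le; rewrite Ha // wbit_behead.
Qed.

Lemma muxF_sound o y a b0 b1 wy wa w0 w1 : sat al (muxF B o y a b0 b1) ->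
  rep B al y wy -> rep B al a wa -> rep B al b0 w0 -> rep B al b1 w1 ->
  rep B al o (mux wy wa w0 w1).
Proof.
move=> /sat_loop H [_ Hy] [sa Ha] [s0 H0] [s1 H1].
split=> [|i c le]; first by case: wy {Hy} => [|[] ?].
have := H i le; rewrite !sat_cat => /and3P[/sat_eqF G1 /sat_eqF G0 /sat_eqF Gn].
move: G1 G0 Gn; rewrite /= /slit /= !Hy //.
case: wy {Hy} => [|[] wy] /= G1 G0 Gn.
- by case: Gn => // ->; rewrite Ha.
- by case: G1 => // ->; rewrite H1.
- by case: G0 => // ->; rewrite H0.
Qed.

End Soundness.

Section Completeness.
Variables (B : nat) (rho : word -> word).

Lemma nilF_complete o : rho o = [::] -> sat (asg rho) (nilF B o).
Proof. by move=> e; apply/sat_loop => i _; apply/sat_noneF => c; rewrite asg_var e. Qed.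

Lemma consF_complete b o a : rho o = b :: rho a -> sat (asg rho) (consF b B o a).
Proof.
move=> e; rewrite sat_cat; apply/andP; split.
  by rewrite /sat /= /slit /= !asg_var e /wbit /= eqxx; case: b {e}.
by apply/sat_loop => i _; apply/sat_eqF; right=> c; rewrite !asg_var e.
Qed.

Lemma tailF_complete o a : size (rho a) <= B -> rho o = behead (rho a) ->
  sat (asg rho) (tailF B o a).
Proof.
move=> sa e; rewrite sat_cat; apply/andP; split.
  apply/sat_noneF => c; rewrite asg_var e wbit_over // size_behead.
  exact: leq_trans (leq_pred _) sa.
by apply/sat_loop => i _; apply/sat_eqF; right=> c; rewrite !asg_var e wbit_behead.
Qed.

Lemma muxF_complete o y a b0 b1 : rho o = mux (rho y) (rho a) (rho b0) (rho b1) ->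
  sat (asg rho) (muxF B o y a b0 b1).
Proof.
move=> e; apply/sat_loop => i _; rewrite !sat_cat.
apply/and3P; split; apply/sat_eqF; rewrite /= /slit /= ?orbF !asg_var ?eqb_id ?eqbF_neg;
  move: e; case: (rho y) => [|[] ?] /= e; rewrite /wbit /=;
  (try by left); right=> c; by rewrite !asg_var e.
Qed.

End Completeness.

Definition copyF (B : nat) (o a : word) : cnf := muxF B o a a a a.

Lemma mux_copy w y : mux y w w w = w.
Proof. by case: y => [|[]]. Qed.

Lemma copyF_sound B al o a w : sat al (copyF B o a) -> rep B al a w -> rep B al o w.
Proof. by move=> H Ha; rewrite -(mux_copy w w); apply: muxF_sound H _ _ _ _. Qed.

Lemma copyF_complete B rho o a : rho o = rho a -> sat (asg rho) (copyF B o a).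
Proof. by move=> e; apply: muxF_complete; rewrite mux_copy. Qed.

(** * Compiling Cobham functions to formulas *)

Record cdata := Cdata {
  cPhi : nat -> word -> seq word -> cnf;
  cW : seq word -> word -> word;
  cc : nat }.

Definition reps (B : nat) (al : nat -> bool) (vs ws : seq word) : Prop :=
  size vs = size ws /\
  forall i, i < size ws -> rep B al (nth [::] vs i) (nth [::] ws i).

Lemma reps_rcons B al vs v ws w :
  reps B al (rcons vs v) (rcons ws w) <-> reps B al vs ws /\ rep B al v w.
Proof.
split=> [[]|[[e H] Hv]].
  rewrite !size_rcons => -[e] H; split; first split=> // i lti.
    by have := H i (leqW lti); rewrite !nth_rcons e lti.
  by have := H _ (leqnn _); rewrite !nth_rcons e ltnn eqxx.
split=> [|i]; first by rewrite !size_rcons e.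
rewrite size_rcons ltnS leq_eqVlt => /orP[/eqP ->|lti].
  by rewrite !nth_rcons e ltnn eqxx.
by rewrite !nth_rcons e lti; apply: H.
Qed.

(* The formula cPhi B ns ins forces the word variable ns to hold f xs as soon
   as the word variables ins hold xs, all lengths involved being at most B.
   Its auxiliary variables have names ns ++ u, and cW xs u is the value the
   one named ns ++ u takes. *)
Definition compiles (n : nat) (f : seq word -> word) (d : cdata) : Prop :=
  (forall k Bf nsf insf, cobN k Bf -> cobham k nsf -> clist k n insf ->
     cobF k (fun xs => cPhi d (Bf xs) (nsf xs) (insf xs))) /\
  forall xs, size xs = n ->
    cW d xs [::] = f xs /\
    forall B ns ins, pol (cc d) (ssz xs) <= B ->
      (forall al, sat al (cPhi d B ns ins) -> reps B al ins xs ->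
         rep B al ns (f xs)) /\
      (forall rho, [seq rho v | v <- ins] = xs ->
         (forall u, rho (ns ++ u) = cW d xs u) -> sat (asg rho) (cPhi d B ns ins)).

Lemma compiles_nil n : exists d, compiles n (fun=> [::]) d.
Proof.
exists (Cdata (fun B ns _ => nilF B ns) (fun _ _ => [::]) 0); split=> /= [*|xs _].
  exact: cobF_nilF.
split=> // B ns ins _; split=> [al H _|rho _ H]; first exact: nilF_sound.
by apply: nilF_complete; rewrite -[ns]cats0.
Qed.

Lemma compiles_proj n i : i < n -> exists d, compiles n (fun xs => nth [::] xs i) d.
Proof.
move=> lin; exists (Cdata (fun B ns ins => copyF B ns (nth [::] ins i))
  (fun xs _ => nth [::] xs i) 0); split=> /= [k Bf nsf insf CB Cns Cins|xs sxs].
  by have C := Cins.2 _ lin; apply: cobF_muxF.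
split=> // B ns ins _; split=> [al H [_ R]|rho e H].
  by apply: copyF_sound H _; apply: R; rewrite sxs.
apply: copyF_complete; rewrite -[ns]cats0 H -e (nth_map [::]) //.
by rewrite -(size_map rho) e sxs.
Qed.

Lemma compiles_succ b : exists d, compiles 1 (fun xs => b :: nth [::] xs 0) d.
Proof.
exists (Cdata (fun B ns ins => consF b B ns (nth [::] ins 0))
  (fun xs _ => b :: nth [::] xs 0) 1); split=> /= [k Bf nsf insf CB Cns Cins|xs sxs].
  by apply: cobF_consF => //; apply: Cins.2.
split=> // B ns ins le; split=> [al H [_ R]|rho e H].
  apply: consF_sound H _; last by apply: R; rewrite sxs.
  apply: leq_trans le; rewrite /pol expn1 ltnS; apply: leq_trans (leq_addr _ _).
  exact: size_nth_ssz.
apply: consF_complete; rewrite -[ns]cats0 H -e (nth_map [::]) //.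
by rewrite -(size_map rho) e sxs.
Qed.

Lemma compiles_ext n f f' d : compiles n f d ->
  (forall xs, size xs = n -> f xs = f' xs) -> compiles n f' d.
Proof. by move=> [H1 H2] e; split=> // xs sxs; rewrite -e //; apply: H2. Qed.

Lemma cobF_finloop k m (G : nat -> seq word -> cnf) :
  (forall i, i < m -> cobF k (G i)) -> cobF k (fun xs => loop m (fun i => G i xs)).
Proof.
elim: m => [|m IH] CG; first by apply: cb_ext (cobF_nil k) _ => xs _; rewrite loop0.
have H : cobF k (fun xs => loop m (fun i => G i xs) ++ G m xs).
  by apply: cobF_cat; [apply: IH => i /leqW; apply: CG | apply: CG].
by apply: cb_ext H _ => xs _; rewrite loopS.
Qed.

(** A self-delimiting prefix: appended to a private name, it separates the auxiliary names of
    distinct copies. *)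
Definition tag (i : nat) (u : word) : word := nseq i false ++ true :: u.

Lemma cob_tag k i u f : cobham k f -> cobham k (fun xs => f xs ++ tag i u).
Proof. by move=> Cf; apply: cob_cat Cf _; apply: cob_const. Qed.

(** The copy of [hs i] writes to the name tagged [i.+1]; the copy of [g] reads those names and
    writes to tag 0. The growth bounds keep the inputs of [g] polynomial in the original size, so
    one width serves all copies. *)
Lemma compiles_comp n m g hs :
  (exists d, compiles m g d) -> (forall i, i < m -> exists d, compiles n (hs i) d) ->
  (forall i, i < m -> exists c, forall xs, size xs = n -> size (hs i xs) <= pol c (ssz xs)) ->
  exists d, compiles n (fun xs => g [seq hs i xs | i <- iota 0 m]) d.
Proof.
move=> [dg [Cg Hg]] /(fin_choice dg)[D HD] /(fin_choice 0)[c Hc].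
pose vs ns := [seq ns ++ tag i.+1 [::] | i <- iota 0 m].
(* [C] bounds the total size of the values of the [hs i]; [e] is the parameter that [pol_comp]
   yields for [pol (cc dg)] of that bound. *)
pose C := \sum_(i < m) (c i).+1; pose e := (C.+1 * cc dg + C + cc dg).+1.
exists (Cdata (fun B ns ins =>
   loop m (fun i => cPhi (D i) B (ns ++ tag i.+1 [::]) ins) ++
   (cPhi dg B (ns ++ tag 0 [::]) (vs ns) ++ copyF B ns (ns ++ tag 0 [::])))
  (fun xs u => let ys := [seq hs i xs | i <- iota 0 m] in
     if u is [::] then g ys else
     let i := index true u in
     if i is j.+1 then cW (D j) xs (drop i.+1 u) else cW dg ys (drop 1 u))
  (\sum_(i < m) cc (D i) + e)); split=> /=.
  move=> k Bf nsf insf CB Cns Cins; apply: cobF_cat; last apply: cobF_cat.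
  - apply: (@cobF_finloop k m (fun i xs =>
      cPhi (D i) (Bf xs) (nsf xs ++ tag i.+1 [::]) (insf xs))) => i lim.
    by apply: (HD i lim).1 => //; apply: cob_tag.
  - apply: Cg => //; first exact: cob_tag.
    by apply: (@clist_mkseq k m (fun i xs => nsf xs ++ tag i.+1 [::])) => i _; apply: cob_tag.
  - by have Ct := cob_tag 0 [::] Cns; apply: cobF_muxF.
move=> xs sxs; split=> // B ns ins leB.
set ys := [seq hs i xs | i <- iota 0 m].
have sys : size ys = m by rewrite size_map size_iota.
have svs : size (vs ns) = m by rewrite size_map size_iota.
have leBi i : i < m -> pol (cc (D i)) (ssz xs) <= B.
  move=> lim; apply: leq_trans leB; apply: pol_mono => //.
  by rewrite (bigD1 (Ordinal lim)) //= -addnA leq_addr.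
have leBg : pol (cc dg) (ssz ys) <= B.
  apply: leq_trans leB; apply: leq_trans (pol_mono (leq_addl _ _) (leqnn _)).
  apply: leq_trans (pol_comp _ _ _); apply: pol_mono => //.
  exact: (ssz_map_bound sxs Hc).
have [eg Hgys] := Hg ys sys.
split=> [al|rho ex H].
  rewrite !sat_cat => /and3P[/sat_loop S1 S2 S3] R.
  apply: copyF_sound S3 _; apply: (Hgys _ _ _ leBg).1 S2 _; split; first by rewrite svs sys.
  move=> i; rewrite sys => lim.
  rewrite !(nth_map 0) ?size_iota // nth_iota // add0n.
  exact: (((HD i lim).2 xs sxs).2 _ _ _ (leBi i lim)).1 (S1 i lim) R.
have Hi i u : rho ((ns ++ tag i.+1 [::]) ++ u) = cW (D i) xs u.
  by rewrite -catA H /tag /= -catA /= index_tag drop_tag.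
have H0 u : rho ((ns ++ tag 0 [::]) ++ u) = cW dg ys u.
  by rewrite -catA H /= drop0.
rewrite !sat_cat; apply/and3P; split.
- apply/sat_loop => i lim.
  by apply: (((HD i lim).2 xs sxs).2 _ _ _ (leBi i lim)).2 => // u; apply: Hi.
- apply: (Hgys _ _ _ leBg).2 => //; rewrite -map_comp; apply/eq_in_map => i.
  rewrite mem_iota add0n => lim /=; have := Hi i [::]; rewrite cats0 => ->.
  by have [] := (HD i lim).2 xs sxs.
- apply: copyF_complete; have := H0 [::]; rewrite cats0 => ->.
  by rewrite eg -[ns]cats0 H.
Qed.

Lemma drop_behead (y : word) j : drop j.+1 y = behead (drop j y).
Proof. by elim: y j => [|b y IH] [|j] //=; rewrite drop0. Qed.

(** The number of recursion steps depends on the input but is at most the width, so the formula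
    unrolls [B] steps. Past the end of the recursion argument the suffix is empty and the
    multiplexer yields [g], which makes surplus steps harmless. *)
Lemma compiles_rec n g (h0 h1 : seq word -> word) f :
  (exists d, compiles n g d) ->
  (exists d, compiles n.+2 h0 d) -> (exists d, compiles n.+2 h1 d) ->
  (forall xs, size xs = n -> f (rcons xs [::]) = g xs) ->
  (forall xs y (b : bool), size xs = n -> f (rcons xs (b :: y)) =
        (if b then h1 else h0) (rcons (rcons xs y) (f (rcons xs y)))) ->
  (exists c, forall xs, size xs = n.+1 -> size (f xs) <= pol c (ssz xs)) ->
  exists d, compiles n.+1 f d.
Proof.
move=> [dg [Cg Hg]] [d0 [C0 H0]] [d1 [C1 H1]] fg fh [cf Hf].
(* nY j holds the suffix of the recursion argument from position j, nF j the
   value of f there, nH b j the value of h_b for the step from j+1 to j; every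
   h_b is evaluated at every j and a multiplexer keeps the relevant result. *)
pose nG ns : word := ns ++ [:: false; false].
pose nY ns j : word := ns ++ [:: false, true & nseq j false].
pose nF ns j : word := ns ++ [:: true, false & nseq j false].
pose nH b ns j : word := ns ++ [:: true, true & tag j [:: b]].
pose args ns xs j := rcons (rcons xs (nY ns j.+1)) (nF ns j.+1).
(* [E] bounds the total size of the arguments of [h0] and [h1]: parameters and suffix together need
   parameter 1, the recursive value needs [cf]. *)
pose E := (1 + cf).+1.
pose e d := (E.+1 * cc d + E + cc d).+1.
exists (Cdata (fun B ns ins => let xs := take n ins in
    copyF B (nY ns 0) (nth [::] ins n) ++
    (loop B (fun j => tailF B (nY ns j.+1) (nY ns j)) ++
    (cPhi dg B (nG ns) xs ++ (copyF B (nF ns B) (nG ns) ++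
    (loop B (fun j => cPhi d0 B (nH false ns j) (args ns xs j) ++
       (cPhi d1 B (nH true ns j) (args ns xs j) ++
        muxF B (nF ns j) (nY ns j) (nG ns) (nH false ns j) (nH true ns j))) ++
     copyF B ns (nF ns 0))))))
  (fun zs u => let xs := take n zs in let y := nth [::] zs n in
    let F j := f (rcons xs (drop j y)) in
    match u with
    | [:: false, false & u'] => cW dg xs u'
    | [:: false, true & u'] => drop (size u') y
    | [:: true, false & u'] => F (size u')
    | [:: true, true & u'] => let j := index true u' in
        if drop j.+1 u' is b :: r then
          cW (if b then d1 else d0) (rcons (rcons xs (drop j.+1 y)) (F j.+1)) r
        else [::]
    | _ => f zs
    end)
  (* The successor makes the parameter positive, so that [B] also bounds the length of the recursion
     argument. *)
  (cc dg + cf + e d0 + e d1).+1); split=> /=.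
  move=> k Bf nsf insf CB Cns Cins.
  have CG := cob_cat Cns (cob_const k [:: false; false]).
  have Cy := Cins.2 n (leqnn _).
  have Cxs : clist k n (fun xs => take n (insf xs)).
    by apply: clist_comp (Cins); rewrite -addn1; apply: clist_take.
  have CY k' ns' N : cobham k' ns' -> cobN k' N -> cobham k' (fun zs => nY (ns' zs) (N zs)).
    by move=> ? ?; apply: cob_cat => //; do 2!apply: cob_cons.
  have CF k' ns' N : cobham k' ns' -> cobN k' N -> cobham k' (fun zs => nF (ns' zs) (N zs)).
    by move=> ? ?; apply: cob_cat => //; do 2!apply: cob_cons.
  have CH b k' ns' N : cobham k' ns' -> cobN k' N -> cobham k' (fun zs => nH b (ns' zs) (N zs)).
    move=> ? ?; apply: cob_cat => //; do 2!apply: cob_cons; apply: cob_cat => //.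
    exact: cob_const.
  have CI : cobN k.+1 (fun zs => size (head [::] zs)) by apply/cobN_size/cob_head.
  have [CBw Cnsw Cxsw CGw] := And4 (cob_wk CB) (cob_wk Cns) (clist_wk Cxs) (cob_wk CG).
  apply: cobF_cat; last apply: cobF_cat; last apply: cobF_cat; last apply: cobF_cat;
    last apply: cobF_cat.
  - by have CY0 := CY _ _ _ Cns (cobN_const k 0); apply: cobF_muxF.
  - apply: (@cobF_loop k (fun xs j => tailF (Bf xs) (nY (nsf xs) j.+1) (nY (nsf xs) j))) => //.
    by apply: cobF_tailF => //; apply: CY => //; apply: cobN_S.
  - exact: Cg.
  - by have CFB := CF _ _ _ Cns CB; apply: cobF_muxF.
  - apply: (@cobF_loop k (fun zs j => let xs := take n (insf zs) in
        let ns := nsf zs in let B := Bf zs in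
        cPhi d0 B (nH false ns j) (args ns xs j) ++
       (cPhi d1 B (nH true ns j) (args ns xs j) ++
        muxF B (nF ns j) (nY ns j) (nG ns) (nH false ns j) (nH true ns j)))) => //=.
    have Ca : clist k.+1 n.+2 (fun zs =>
        args (nsf (behead zs)) (take n (insf (behead zs))) (size (head [::] zs))).
      by apply: clist_rcons; [apply: CF => //; apply: cobN_S |
        apply: clist_rcons => //; apply: CY => //; apply: cobN_S].
    apply: cobF_cat; last apply: cobF_cat.
    + by apply: C0 => //; apply: CH.
    + by apply: C1 => //; apply: CH.
    + by apply: cobF_muxF => //; [apply: CF | apply: CY | apply: CH | apply: CH].
  - by have CF0 := CF _ _ _ Cns (cobN_const k 0); apply: cobF_muxF.
case/lastP=> // xs y; rewrite size_rcons => -[sxs]; split=> // B ns ins leB.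
have tk T (s : seq T) x : size s = n -> take n (rcons s x) = s.
  by move=> <-; rewrite -cats1 take_size_cat.
have tl (s : seq word) x : size s = n -> nth [::] (rcons s x) n = x.
  by move=> <-; rewrite nth_rcons ltnn eqxx.
rewrite tk // tl //.
pose F j := f (rcons xs (drop j y)).
pose A j := rcons (rcons xs (drop j.+1 y)) (F j.+1).
have sA j : size (A j) = n.+2 by rewrite !size_rcons sxs.
(* Both recursion equations in one, in the shape that the multiplexer computes. *)
have FE j : F j = mux (drop j y) (g xs) (h0 (A j)) (h1 (A j)).
  rewrite /F /A /F drop_behead; case: (drop j y) => [|b y']; first exact: fg.
  by rewrite fh //; case: b.
have FB j : B <= j -> size y <= B -> F j = g xs.
  by move=> leBj sy; rewrite /F drop_oversize ?fg // (leq_trans sy).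
set s := ssz (rcons xs y) in leB.
have sxE : s = ssz xs + size y by rewrite /s ssz_rcons.
have sF j : size (F j) <= pol cf s.
  apply: leq_trans (Hf _ _) _; first by rewrite size_rcons sxs.
  by apply: pol_mono => //; rewrite ssz_rcons sxE leq_add2l size_drop leq_subr.
have ltc d : d <= cc dg + cf + e d0 + e d1 -> pol d s <= B.
  by move=> led; apply: leq_trans leB; apply: pol_mono => //; apply: leqW.
have leg : pol (cc dg) (ssz xs) <= B.
  apply: leq_trans (ltc (cc dg) _); last by rewrite -!addnA leq_addr.
  by apply: pol_mono => //; rewrite sxE leq_addr.
have sAj j : ssz (A j) <= pol E s.
  rewrite !ssz_rcons; apply: leq_trans (pol_add _ _ _); apply: leq_add => //.
  apply: leq_trans (leq_pol _ _) => //.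
  by rewrite sxE leq_add2l size_drop leq_subr.
have le0 j : pol (cc d0) (ssz (A j)) <= B.
  apply: leq_trans (ltc (e d0) _); last by rewrite -addnA addnCA leq_addr.
  by apply: leq_trans (pol_comp _ _ _); apply: pol_mono.
have le1 j : pol (cc d1) (ssz (A j)) <= B.
  apply: leq_trans (ltc (e d1) _); last by rewrite leq_addl.
  by apply: leq_trans (pol_comp _ _ _); apply: pol_mono.
have sy : size y <= B.
  apply: leq_trans leB; apply: leq_trans (leq_pol _ (ltn0Sn _)).
  by rewrite sxE leq_addl.
have [eg Hg'] := Hg xs sxs; split=> [al|rho].
  rewrite !sat_cat => /and3P[SY /sat_loop ST /and3P[SG SFB /andP[/sat_loop SH SF]]].
  case/lastP: ins SY SG SH => [_ _ _ []|ins iy]; first by rewrite size_rcons.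
  move=> SY SG SH R0; have /reps_rcons[R Ry] := R0.
  have sins : size ins = n by have [->] := R.
  rewrite tk // tl // in SY SG SH.
  have RY j : j <= B -> rep B al (nY ns j) (drop j y).
    elim: j => [_|j IH ltj]; first by rewrite drop0; apply: copyF_sound SY Ry.
    rewrite drop_behead; apply: tailF_sound (ST j ltj) (IH _); exact: ltnW.
  have RG : rep B al (nG ns) (g xs) by apply: (Hg' _ _ _ leg).1 SG R.
  (* Downward induction on the position, starting at [B], where the suffix is empty and the value is
     that of [g]. *)
  have RF j : j <= B -> rep B al (nF ns (B - j)) (F (B - j)).
    elim: j => [_|j IH ltj].
      by rewrite subn0 FB //; apply: copyF_sound SFB RG.
    have ltB : B - j.+1 < B by rewrite -subSn // subSS leq_subr.
    have := SH _ ltB; rewrite !sat_cat => /and3P[S0 S1 SM].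
    have eB : (B - j.+1).+1 = B - j by rewrite -subSn // subSS.
    have RA : reps B al (args ns ins (B - j.+1)) (A (B - j.+1)).
      apply/reps_rcons; split; last by rewrite eB; apply: IH; apply: ltnW.
      by apply/reps_rcons; split=> //; apply: RY.
    rewrite FE; apply: muxF_sound SM _ RG _ _.
    + by apply: RY; apply: ltnW.
    + exact: ((H0 _ (sA _)).2 _ _ _ (le0 _)).1 S0 RA.
    + exact: ((H1 _ (sA _)).2 _ _ _ (le1 _)).1 S1 RA.
  apply: copyF_sound SF _; have := RF B (leqnn B).
  by rewrite subnn /F drop0.
case/lastP: ins => [/(congr1 size)|ins iy]; first by rewrite size_rcons.
rewrite map_rcons => /rcons_inj[ex ey] H.
have sins : size ins = n by rewrite -(size_map rho) ex.
rewrite tk // tl //.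
have HG u : rho (nG ns ++ u) = cW dg xs u by rewrite -catA H.
have HG0 : rho (nG ns) = g xs by rewrite -eg -HG cats0.
have HY j : rho (nY ns j) = drop j y by rewrite H /= size_nseq.
have HF j : rho (nF ns j) = F j by rewrite H /= size_nseq.
have HH b j u : rho (nH b ns j ++ u) = cW (if b then d1 else d0) (A j) u.
  by rewrite -catA H /= /tag -catA index_tag drop_tag.
have HA j : [seq rho v | v <- args ns ins j] = A j.
  by rewrite !map_rcons ex HY HF.
rewrite !sat_cat; apply/and3P; split; last (apply/and3P; split; last (apply/andP; split)).
- by apply: copyF_complete; rewrite HY drop0 ey.
- apply/sat_loop => j _; apply: tailF_complete; rewrite !HY ?drop_behead //.
  by rewrite size_drop; apply: leq_trans (leq_subr _ _) sy.
- exact: (Hg' _ _ _ leg).2.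
- by apply: copyF_complete; rewrite HF HG0 FB.
- apply/sat_loop => j _; rewrite !sat_cat; apply/and3P; split.
  + by apply: ((H0 _ (sA j)).2 _ _ _ (le0 j)).2 => // u; rewrite HH.
  + by apply: ((H1 _ (sA j)).2 _ _ _ (le1 j)).2 => // u; rewrite HH.
  + apply: muxF_complete; rewrite HF HY HG0 FE.
    have := HH false j [::]; rewrite cats0 => ->; rewrite (H0 _ (sA j)).1.
    by have := HH true j [::]; rewrite cats0 => ->; rewrite (H1 _ (sA j)).1.
- by apply: copyF_complete; rewrite HF /F drop0 -[ns]cats0 H.
Qed.

(** Smash is iterated padding, and padding is iterated [false ::], both by recursion on notation.
    The growth bounds come from membership in the algebra. *)
Lemma compiles_smash : exists d, compiles 2 (fun xs =>
  nseq (size (nth [::] xs 0) * size (nth [::] xs 1)) false) d.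
Proof.
have two (xs : seq word) y : size xs = 1 -> exists2 x, xs = [:: x] & rcons xs y = [:: x; y].
  by case: xs => [|x []] // _; exists x.
have sz n i (lin : i < n) :
    exists c, forall xs, size xs = n -> size (nth [::] xs i) <= pol c (ssz xs).
  exact/cobham_size/cb_proj.
have push : exists d, compiles 3 (fun xs => false :: nth [::] xs 2) d.
  apply: (@compiles_comp 3 1 _ (fun=> fun xs => nth [::] xs 2) (compiles_succ false)) => i _.
    exact: compiles_proj.
  exact: sz.
pose pad xs : word := nseq (size (nth [::] xs 1)) false ++ nth [::] xs 0.
have Cpad : exists d, compiles 2 pad d.
  apply: (@compiles_rec 1 _ _ _ _ (compiles_proj (ltn0Sn 0)) push push) => [xs s1|xs y b s1|].
  - by have [x -> ->] := two xs [::] s1.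
  - have [x -> ->] := two xs (b :: y) s1; case: b => //=.
  - apply: cobham_size; apply: cob_cat; last exact: cb_proj.
    by apply: cobN_size; apply: cb_proj.
have step : exists d, compiles 3 (fun xs => pad [:: nth [::] xs 2; nth [::] xs 0]) d.
  apply: (@compiles_comp 3 2 _ (fun i xs => nth [::] xs (if i is 0 then 2 else 0)) Cpad) => -[|i] _.
  - exact: compiles_proj.
  - exact: compiles_proj.
  - exact: sz.
  - exact: sz.
apply: (compiles_rec (compiles_nil 1) step step) => [xs s1|xs y b s1|].
- by have [x -> ->] := two xs [::] s1; rewrite muln0.
- have [x -> ->] := two xs (b :: y) s1.
  by rewrite (_ : (if b then _ else _) = fun xs => pad [:: nth [::] xs 2; nth [::] xs 0]);
    [rewrite /pad /= mulnS nseqD | case: b].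
- exact/cobham_size/cb_smash.
Qed.

Lemma cobham_compiles n f : cobham n f -> exists d, compiles n f d.
Proof.
elim=> {n f}.
- exact: compiles_nil.
- exact: compiles_proj.
- exact: compiles_succ.
- exact: compiles_smash.
- move=> n m g hs _ Hg Ch Hh; apply: compiles_comp => // i /Ch; exact: cobham_size.
- move=> n g h0 h1 k f Cg Hg C0 H0 C1 H1 Ck _ fg fh bnd.
  apply: (compiles_rec Hg H0 H1 fg fh); exact: (cobham_size (cb_rec Cg C0 C1 Ck fg fh bnd)).
- by move=> n f f' _ [d Hd] e; exists d; apply: compiles_ext Hd e.
Qed.

(** * Encodings and search trees *)

Lemma binaryK n : foldr (fun (b : bool) m => b + m.*2) 0 (binary n) = n.
Proof.
rewrite /binary; suff H k m : m <= k -> foldr (fun (b : bool) m => b + m.*2) 0 (bits_aux k m) = m.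
  exact: H.
elim: k m => [|k IH] [|m] //= le.
rewrite IH; first exact: (odd_double_half m.+1).
by rewrite leq_uphalf_double -addnn (leq_trans (le : m <= k)) ?leq_addr.
Qed.

Lemma binary_inj : injective binary.
Proof. exact: can_inj binaryK. Qed.

(** Data bits are pairs starting with [true] and markers are pairs starting with [false], so reading
    pair by pair finds where the digits end. *)
Lemma enc_bits_inj s1 s2 r1 r2 :
  hom enc_bit s1 ++ SEP ++ r1 = hom enc_bit s2 ++ SEP ++ r2 -> s1 = s2 /\ r1 = r2.
Proof.
elim: s1 s2 => [|[] s1 IH] [|[] s2] //=; rewrite /hom //=.
- by case.
- by case=> /IH[-> ->].
- by case=> /IH[-> ->].
Qed.

Lemma enc_clause_inj C1 C2 r1 r2 :
  enc_clause C1 ++ r1 = enc_clause C2 ++ r2 -> C1 = C2 /\ r1 = r2.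
Proof.
rewrite /enc_clause -!catA; elim: C1 C2 => [|[v1 p1] C1 IH] [|[v2 p2] C2] //=.
- by case.
- by rewrite /enc_lit; case: p2.
- by rewrite /enc_lit; case: p1.
rewrite /enc_lit /= -!catA => H.
have [ep {}H] : p1 = p2 /\ enc_nat v1 ++ SEP ++ (flatten [seq enc_lit l | l <- C1] ++ ENDc ++ r1)
    = enc_nat v2 ++ SEP ++ (flatten [seq enc_lit l | l <- C2] ++ ENDc ++ r2).
  by case: p1 p2 H => [] [] //= [].
by have [/binary_inj -> /IH[-> ->]] := enc_bits_inj H; rewrite ep.
Qed.

Lemma enc_cnf_inj F1 F2 r1 r2 :
  enc_cnf F1 ++ r1 = enc_cnf F2 ++ r2 -> F1 = F2 /\ r1 = r2.
Proof.
(* A clause never starts with two [false] bits, which distinguishes it from the closing [SEP]. *)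
have start C r : exists b r',
    enc_clause C ++ r = b :: true :: r' \/ enc_clause C ++ r = true :: b :: r'.
  by case: C => [|[v []] C]; do 2!eexists; [left|right|right].
rewrite /enc_cnf -!catA; elim: F1 F2 => [|C1 F1 IH] [|C2 F2] //=.
- by case.
- rewrite -catA; set r := flatten _ ++ _.
  by have [b [r' []]] := start C2 r; move=> ->.
- rewrite -catA; set r := flatten _ ++ _.
  by have [b [r' []]] := start C1 r; move=> ->.
by rewrite -!(catA (enc_clause _)) => /enc_clause_inj[-> /IH[-> ->]].
Qed.

Lemma encode_inj F1 F2 k1 k2 : encode F1 k1 = encode F2 k2 -> F1 = F2 /\ k1 = k2.
Proof.
move=> /enc_cnf_inj[-> e]; split=> //; apply: binary_inj.
(* The digits of [k] end the word with no marker, so [SEP] is appended on both sides before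
   decoding. *)
by have [] := @enc_bits_inj (binary k1) (binary k2) [::] [::]; rewrite /hom -?/(enc_nat _) ?e.
Qed.

(** * Satisfiability under assignments and simplification *)

Definition satisfiable (F : cnf) : Prop := exists al, sat al F.

Lemma slit_neg al l : slit al (neg l) = ~~ slit al l.
Proof. by rewrite /slit /neg /=; case: (al _) l.2 => [] []. Qed.

Lemma mem_vars (F : cnf) x :
  reflect (exists C m, [/\ C \in F, m \in C & m.1 = x]) (x \in vars F).
Proof.
rewrite mem_undup; apply: (iffP mapP) => [[m /flattenP[C CF mC] ->]|[C [m [CF mC <-]]]].
  by exists C, m.
by exists m => //; apply/flattenP; exists C.
Qed.

Lemma sat_eq_vars al al' F : {in vars F, al =1 al'} -> sat al F = sat al' F.
Proof.
move=> e; apply: eq_in_all => C CF; apply: eq_in_has => m mC.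
by rewrite /slit e //; apply/mem_vars; exists C, m.
Qed.

Lemma vars_assign F l x : x \in vars (assign F l) -> x \in vars F /\ x != l.1.
Proof.
case/mem_vars=> C [m [/mapP[C' + ->]]]; rewrite !mem_filter => /andP[lC CF] /andP[ml mC] <-.
split; first by apply/mem_vars; exists C', m.
apply: contraNneq lC => e; suff <- : m = l by [].
by case: m l ml e {mC} => [v b] [v' b']; rewrite /neg xpair_eqE /= => + e;
  rewrite e eqxx; case: b b' => [] [].
Qed.

Lemma sat_assign al F l : slit al l -> sat al (assign F l) = sat al F.
Proof.
move=> al_l; rewrite /sat /assign all_map all_filter; apply: eq_all => C /=.
have [lC|lC] /= := boolP (l \in C); first by symmetry; apply/hasP; exists l.
rewrite has_filter -filter_predI -has_filter; apply: eq_has => m /=.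
by have [->|] := eqVneq m (neg l); rewrite ?andbT // slit_neg al_l.
Qed.

Definition upd (al : nat -> bool) (l : lit) (n : nat) : bool :=
  if n == l.1 then l.2 else al n.

(** The variable of [l] is absent from [assign F l], so making [l] true does not disturb the
    model. *)
Lemma sat_upd al F l : sat al (assign F l) -> sat (upd al l) F.
Proof.
move=> H; rewrite -(@sat_assign _ F l) ?/slit ?/upd ?eqxx //.
rewrite (@sat_eq_vars _ al) // => n /vars_assign[_ /negbTE ne].
by rewrite /= ne.
Qed.

Lemma satisfiable_assign F x :
  satisfiable F <-> satisfiable (assign F (x, false)) \/ satisfiable (assign F (x, true)).
Proof.
split=> [[al H]|]; last by case=> -[al /sat_upd H]; eexists; exact: H.
by case E: (al x); [right|left]; exists al; rewrite sat_assign ///slit /= E.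
Qed.

Lemma dstep_vars F G : dstep F = Some G -> {subset vars G <= vars F}.
Proof.
rewrite /dstep; case: (has_empty F) => //.
by case: (unit_lit F) => [l [<-] x /vars_assign[]|]//;
  case: (pure_lit F) => // l [<-] x /vars_assign[].
Qed.

Lemma dstep_satisfiable F G : dstep F = Some G -> (satisfiable F <-> satisfiable G).
Proof.
rewrite /dstep; case: (has_empty F) => //.
have back l : satisfiable (assign F l) -> satisfiable F.
  by case=> al /sat_upd H; eexists; exact: H.
case E: (unit_lit F) => [l|].
  (* A unit clause forces every model to make [l] true, so the same [al] serves. *)
  case=> <-; split=> [[al H]|]; last exact: back.
  exists al; rewrite sat_assign //; move: E; rewrite /unit_lit.
  case E: [seq _ <- F | _] => [//|C s] Cl.
  have: C \in [seq C <- F | size (undup C) == 1] by rewrite E mem_head.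
  rewrite mem_filter => /andP[/eqP s1 /(allP H) /hasP[m mC alm]].
  have lC : l \in C by case: C Cl {E s1 mC} => //= ? ? [->]; rewrite mem_head.
  move: mC lC; rewrite -!(mem_undup C); case: (undup C) s1 => [|a []] // _.
  by rewrite !inE => /eqP <- /eqP ->.
(* No clause contains the complement of a pure literal, so the remaining clauses are unshortened and
   [al] still satisfies them, whatever value it gives [l]. *)
case E': (pure_lit F) => [l|//] [<-]; split=> [[al H]|]; last exact: back.
have: l \in [seq l <- flatten F | neg l \notin flatten F].
  by move: E'; rewrite /pure_lit; case: [seq _ <- _ | _] => //= ? ? [->]; rewrite mem_head.
rewrite mem_filter => /andP[nl _]; exists al.
apply/allP => _ /mapP[C + ->]; rewrite mem_filter => /andP[_ CF].
have /hasP[m mC alm] := allP H _ CF; apply/hasP; exists m => //.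
rewrite mem_filter mC andbT; apply: contraNneq nl => <-.
by apply/flattenP; exists C.
Qed.

Lemma D_vars F : {subset vars (D F) <= vars F}.
Proof.
rewrite /D; move: (_.+1) => n; elim: n F => [|n IH] F x //=.
by case E: (dstep F) => [G|] // /IH; apply: dstep_vars.
Qed.

Lemma D_satisfiable F : satisfiable F <-> satisfiable (D F).
Proof.
rewrite /D; move: (_.+1) => n; elim: n F => [|n IH] F //=.
case E: (dstep F) => [G|] //; exact: iff_trans (dstep_satisfiable E) (IH G).
Qed.

(* Search trees with a simplification P before each test: P = id gives
   backtracking trees and P = D gives DPLL trees. *)
Fixpoint is_tree (P : cnf -> cnf) (F : cnf) (T : tree) : Prop :=
  match T with
  | Leaf => has_empty (P F)
  | Node x T1 T2 => ~~ has_empty (P F) /\ x \in vars (P F) /\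
      is_tree P (P (assign F (x, false))) T1 /\ is_tree P (P (assign F (x, true))) T2
  end.

Lemma is_tree_BST F T : is_tree id F T = is_BST F T.
Proof. by elim: T F => //= x T1 IH1 T2 IH2 F; rewrite IH1 IH2. Qed.

Lemma is_tree_DST F T : is_tree D F T = is_DST F T.
Proof. by elim: T F => //= x T1 IH1 T2 IH2 F; rewrite IH1 IH2. Qed.

(** A formula with neither a variable nor the empty clause has no clauses, hence is satisfiable. *)
Lemma unsat_var F : ~ satisfiable F -> ~~ has_empty F -> exists x, x \in vars F.
Proof.
case: F => [|[|l C] F] // unF _; first by case: unF; exists xpred0.
by exists l.1; apply/mem_vars; exists (l :: C), l; rewrite !mem_head.
Qed.

(** * Refutation by search trees and their size *)

Section Trees.
Variable P : cnf -> cnf.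
Hypothesis P_vars : forall F, {subset vars (P F) <= vars F}.
Hypothesis P_satisfiable : forall F, satisfiable F <-> satisfiable (P F).

Lemma tree_unsat F T : is_tree P F T -> ~ satisfiable F.
Proof.
elim: T F => [|x T1 IH1 T2 IH2] F /=.
  by move=> e /P_satisfiable[al /allP /(_ _ e)].
case=> _ [_ [/IH1 u1 /IH2 u2]] /(satisfiable_assign F x).
by case=> /P_satisfiable; [apply: u1 | apply: u2].
Qed.

(** Branch on any variable that survives [P]: it disappears from both branches, so the depth is at
    most [n], and a binary tree of that depth has fewer than [2 ^ n] nodes. *)
Lemma unsat_tree n F : size (vars F) <= n -> ~ satisfiable F ->
  exists T, is_tree P F T /\ Defs.tsize T < 2 ^ n.
Proof.
elim: n F => [|n IH] F leF unF; (have [e|e] := boolP (has_empty (P F));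
  first by exists Leaf; rewrite /= e expn_gt0);
  (have [x xP] : exists x, x \in vars (P F)
    by exact: (unsat_var (fun h => unF ((P_satisfiable F).2 h)) e)).
  by move: leF (P_vars xP); rewrite leqn0 size_eq0 => /eqP ->.
have sub b : exists T, is_tree P (P (assign F (x, b))) T /\ Defs.tsize T < 2 ^ n.
  apply: IH.
    rewrite -ltnS; apply: leq_trans leF.
    (* [x] and the variables of the branch are distinct variables of [F], which gives the drop by
       one. *)
    apply: (@uniq_leq_size _ (x :: vars (P (assign F (x, b))))).
      rewrite /= undup_uniq andbT; apply/negP => /P_vars /vars_assign[_].
      by rewrite eqxx.
    by move=> y; rewrite inE => /orP[/eqP -> |/P_vars /vars_assign[]//]; apply: P_vars.
  move=> /(proj2 (P_satisfiable (assign F (x, b)))) H; apply/unF/(satisfiable_assign F x).2.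
  by case: b H => H; [right|left].
have [[T1 [H1 s1]] [T2 [H2 s2]]] := (sub false, sub true).
exists (Node x T1 T2); rewrite /= e xP; split=> //.
by rewrite expnS mul2n -addnn -addSn -addnS leq_add.
Qed.

End Trees.

(** * The reduction *)

(** The witness is the output of no gate, so clauses must ensure that its variables describe some
    word of length at most [p]: bits are exclusive, occupied positions form an initial segment,
    position [p] is empty. *)
Definition wellF (p B : nat) (v : word) : cnf :=
  loop B.+1 (fun i => [:: [:: nlit v i true; nlit v i false]]) ++
  (loop B (fun i => [:: [:: nlit v i.+1 true; plit v i true; plit v i false];
                        [:: nlit v i.+1 false; plit v i true; plit v i false]]) ++
   noneF v p).

Lemma cobF_wellF n p B v : cobN n p -> cobN n B -> cobham n v ->
  cobF n (fun xs => wellF (p xs) (B xs) (v xs)).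
Proof.
move=> Cp CB Cv; have Cvw := cob_wk Cv.
have CI : cobN n.+1 (fun zs => size (head [::] zs)) by apply/cobN_size/cob_head.
have CS := cobN_S CI; have Cnil := cobC_nil n.+1.
apply: cobF_cat; last apply: cobF_cat; last exact: cobF_noneF.
  apply: (@cobF_loop n (fun xs i => [:: [:: nlit (v xs) i true; nlit (v xs) i false]]));
    last exact: cobN_S.
  by apply: cobF_cons; [do 2!apply: cobC_neg => // | apply: cobF_nil].
apply: (@cobF_loop n (fun xs i =>
  [:: [:: nlit (v xs) i.+1 true; plit (v xs) i true; plit (v xs) i false];
      [:: nlit (v xs) i.+1 false; plit (v xs) i true; plit (v xs) i false]])) => //.
by do 2!(apply: cobF_cons; first by apply: cobC_neg => //; do 2!apply: cobC_pos => //);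
  apply: cobF_nil.
Qed.

Lemma wellF_sound p B al v : p <= B -> sat al (wellF p B v) ->
  exists2 w, size w <= p & rep B al v w.
Proof.
move=> lepB; rewrite !sat_cat => /and3P[/sat_loop excl /sat_loop down /sat_noneF none].
pose absent i := ~~ al (var v i true) && ~~ al (var v i false).
(* The length of the word is the least empty position. *)
have [l abl minl] : exists2 l, absent l & forall i, i < l -> ~~ absent i.
  have ex : exists l, absent l by exists p; rewrite /absent !none.
  exists (ex_minn ex); case: ex_minnP => // l _ H i; apply: contraTN => /H.
  by rewrite -leqNgt.
have lep : l <= p by rewrite leqNgt; apply/negP => /minl; rewrite /absent !none.
(* Emptiness propagates upwards from [l], since an occupied position needs an occupied
   predecessor. *)
have over i c : l <= i -> i <= B -> al (var v i c) = false.
  move=> + leiB; elim: i leiB c => [|i IH] leiB c leli.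
    by move: abl; case: l {minl lep} leli => // _ /andP[]; case: c => /negbTE + /negbTE.
  move: leli; rewrite leq_eqVlt => /orP[/eqP <-|ltli].
    by move: abl => /andP[]; case: c => /negbTE + /negbTE.
  have := down i leiB; rewrite /sat /= /slit /= !(IH (ltnW leiB)) //=.
  by rewrite !orbF !eqbF_neg andbT => /andP[]; case: c => /negbTE + /negbTE.
exists (mkseq (fun i => al (var v i true)) l); first by rewrite size_mkseq.
split=> [|i c leiB]; first by rewrite size_mkseq (leq_trans lep).
rewrite /wbit size_mkseq; have [leli|ltil] := leqP l i; first exact: over.
rewrite nth_mkseq //=; have := excl i leiB; have := minl i ltil.
rewrite /absent /sat /= /slit /= !eqbF_neg.
by case: c; case: (al (var v i true)); case: (al (var v i false)).
Qed.

Lemma wellF_complete p B rho v : size (rho v) <= p -> sat (asg rho) (wellF p B v).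
Proof.
move=> sv; rewrite !sat_cat; apply/and3P; split.
- apply/sat_loop => i _; rewrite /sat /= /slit /= !asg_var /wbit.
  by case: (_ < _) => //; case: (nth _ _ _).
- apply/sat_loop => i _; rewrite /sat /= /slit /= !asg_var /wbit.
  have [/ltnW -> |_] := boolP (i.+1 < _); first by case: (nth _ _ i); rewrite !orbT.
  by [].
- by apply/sat_noneF => c; rewrite asg_var wbit_over.
Qed.

(** [xname j] names the suffix of length [j] of the input. The three kinds of names start
    differently, so the auxiliary names extending [rname] meet none of the others. *)
Definition xname (j : nat) : word := [:: false, false & nseq j false].
Definition yname : word := [:: false; true].
Definition rname : word := [:: true].

(** The input enters through one gate per suffix, each fixing one bit, which a loop over the
    suffixes of [x] can write. *)
Fixpoint inputF (B : nat) (x : word) : cnf :=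
  if x is b :: x' then consF b B (xname (size x)) (xname (size x')) ++ inputF B x'
  else nilF B (xname 0).

Lemma inputF_cons B b x :
  inputF B (b :: x) = consF b B (xname (size x).+1) (xname (size x)) ++ inputF B x.
Proof. by []. Qed.

Lemma cobF_inputF n B x : cobN n B -> cobham n x ->
  cobF n (fun xs => inputF (B xs) (x xs)).
Proof.
move=> CB Cx.
have Cname k N : cobN k N -> cobham k (fun zs => xname (N zs)).
  by move=> ?; do 2!apply: cob_cons.
have CI : cobN n.+1 (fun zs => size (head [::] zs)) by apply/cobN_size/cob_head.
have Cloop := @cob_catloop n (fun b xs y =>
  encs (consF b (B xs) (xname (size y).+1) (xname (size y)))) x.
have Cnil := cobF_nilF CB (Cname n _ (cobN_const n 0)).
apply: cb_ext (cob_cat (Cloop _ Cx) Cnil) _ => [b|xs _].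
  apply: (@cobF_consF _ (fun zs => B (behead zs)) (cob_wk CB)); apply: Cname => //.
  exact: cobN_S.
elim: (x xs) => // b y IH; rewrite inputF_cons encs_cat -IH.
by rewrite catA.
Qed.

Lemma inputF_sound B al x : size x <= B -> sat al (inputF B x) ->
  rep B al (xname (size x)) x.
Proof.
elim: x => [_|b x IH lt]; first exact: nilF_sound.
rewrite inputF_cons sat_cat => /andP[S1 S2]; apply: consF_sound S1 (IH _ S2) => //; exact: ltnW.
Qed.

Lemma inputF_complete B rho x :
  (forall j, j <= size x -> rho (xname j) = drop (size x - j) x) ->
  sat (asg rho) (inputF B x).
Proof.
elim: x => [|b x IH] H; first by apply: nilF_complete; rewrite H.
rewrite inputF_cons sat_cat; apply/andP; split.
  by apply: consF_complete;
    rewrite (H (size x).+1) // (H (size x)) ?leqnSn // subnn subSnn /= drop0.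
by apply: IH => j lej; rewrite H ?subSn //; apply: leqW.
Qed.

Definition acceptF (v : word) : cnf :=
  [:: [:: plit v 0 true]; [:: nlit v 1 true]; [:: nlit v 1 false]].

Lemma cobF_acceptF n v : cobham n v -> cobF n (fun xs => acceptF (v xs)).
Proof.
move=> Cv; have Cnil := cobC_nil n; have C0 := cobN_const n 0; have C1 := cobN_const n 1.
by do 3!(apply: cobF_cons; first by [apply: cobC_pos | apply: cobC_neg]); apply: cobF_nil.
Qed.

Lemma accept_wbit w :
  [&& wbit w 0 true, ~~ wbit w 1 true & ~~ wbit w 1 false] -> w = [:: true].
Proof. by case: w => [|[] [|[] w]]. Qed.

Lemma sat_acceptF al v : sat al (acceptF v) =
  [&& al (var v 0 true), ~~ al (var v 1 true) & ~~ al (var v 1 false)].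
Proof. by rewrite /sat /= /slit /= !orbF eqb_id !eqbF_neg andbT. Qed.

(** * The Cook-Levin formula of a verifier *)

Section CookLevin.
Variables (R : seq word -> word) (c : nat) (d : cdata).
Hypothesis Rd : compiles 2 R d.

Definition wit_size (x : word) : nat := c * size x ^ c + c.
(** Wide enough for the computation, the input and the witness; the successor brings position 1,
    which [acceptF] reads, within the width. *)
Definition width (x : word) : nat := (pol (cc d) (size x + wit_size x) + (size x + wit_size x)).+1.

Definition tableau (x : word) : cnf :=
  let B := width x in
  inputF B x ++ (wellF (wit_size x) B yname ++
    (cPhi d B rname [:: xname (size x); yname] ++ acceptF rname)).

Lemma cobF_tableau : cobF 1 (fun xs => tableau (head [::] xs)).
Proof.
have Cx := cob_head 0; have CN := cobN_size Cx.
have Cp : cobN 1 (fun xs => wit_size (head [::] xs)).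
  by apply: cobN_add; [apply: cobN_mul; [apply: cobN_const | apply: cobN_exp] | apply: cobN_const].
have CB : cobN 1 (fun xs => width (head [::] xs)).
  by apply/cobN_S/cobN_add; [apply/cobN_pol/cobN_add | apply: cobN_add].
have Cy := cob_const 1 yname; have Cr := cob_const 1 rname.
apply: cobF_cat; first exact: cobF_inputF.
apply: cobF_cat; first exact: cobF_wellF.
apply: cobF_cat; last exact: cobF_acceptF.
apply: Rd.1 => //; apply: clist_cons; first by do 2!apply: cob_cons.
exact: (clist_cons Cy (clist_nil 1)).
Qed.

(** From a model one reads off a witness; a witness determines the intended value of every name, and
    these values give a model. *)
Lemma tableauP x : satisfiable (tableau x) <->
  exists y, size y <= wit_size x /\ R [:: x; y] = [:: true].
Proof.
have lep : wit_size x <= width x by rewrite leqW // addnA leq_addl.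
have lex : size x <= width x by rewrite leqW // addnCA leq_addr.
have leB y : size y <= wit_size x -> pol (cc d) (ssz [:: x; y]) <= width x.
  move=> sy; rewrite leqW //; apply: leq_trans (leq_addr _ _); apply: pol_mono => //.
  by rewrite /ssz /= addn0 leq_add2l.
split=> [[al]|[y [sy Ry]]].
  rewrite /tableau sat_cat
    (sat_cat _ (wellF _ _ _)) (sat_cat _ (cPhi _ _ _ _)) => /and4P[S1 S2 S3 S4].
  have [y sy Hy] := wellF_sound lep S2; exists y; split=> //.
  have [_ /(_ _ rname [:: xname (size x); yname] (leB y sy))[Hs _]] := Rd.2 [:: x; y] erefl.
  have [] := Hs al S3.
    split=> // -[|[|//]] _ //=; exact: inputF_sound.
  move=> _ H; apply: accept_wbit; rewrite -!H //; by rewrite -sat_acceptF.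
(* The first bits of a name decide its meaning: a suffix of the input, the witness, or a value in
   the computation of [R]. *)
pose rho v := match v with
  | [:: false, false & u] => drop (size x - size u) x
  | [:: false, true & _] => y
  | true :: u => cW d [:: x; y] u
  | _ => [::]
  end.
have [e0 /(_ _ rname [:: xname (size x); yname] (leB y sy))[_ Hc]] := Rd.2 [:: x; y] erefl.
exists (asg rho); rewrite /tableau sat_cat
    (sat_cat _ (wellF _ _ _)) (sat_cat _ (cPhi _ _ _ _)); apply/and4P; split.
- by apply: inputF_complete => j lej; rewrite /= size_nseq.
- exact: wellF_complete.
- by apply: Hc => //=; rewrite size_nseq subnn drop0.
- by rewrite sat_acceptF !asg_var /= e0 Ry.
Qed.

End CookLevin.

(** Equal to [2 ^ (m + 1) - 1] for [m] the length of the encoding, which bounds the number of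
    variables. Its binary digits are [m + 1] ones, so it is written by replacing each bit of the
    encoding by a one. *)
Definition full_bound (F : cnf) : nat := code (nseq (size (enc_cnf F)) true).

Lemma full_boundE F : (full_bound F).+1 = 2 ^ (size (enc_cnf F)).+1.
Proof.
rewrite /full_bound; elim: (size _) => //= n IH.
by rewrite expnS -IH mul2n doubleS add1n.
Qed.

Lemma cob_encode n F : cobF n F -> cobham n (fun xs => encode (F xs) (full_bound (F xs))).
Proof.
move=> CF; have CE : cobham n (fun xs => enc_cnf (F xs)).
  by apply: cob_cat => //; apply: cob_const.
have Ck := cob_cat (cob_hom (fun=> D1) CE) (cob_const n D1).
apply: cb_ext (cob_cat CE Ck) _ => xs _; congr (_ ++ _).
rewrite /enc_nat binary_code map_rcons flatten_rcons; congr (_ ++ _).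
by rewrite /hom; elim: (enc_cnf _) => //= b s ->.
Qed.

Lemma size_vars_enc F : size (vars F) <= size (enc_cnf F).
Proof.
apply: leq_trans (size_undup _) _; rewrite size_map size_cat; apply: leq_trans (leq_addr _ _).
rewrite /encs; elim: F => //= C F IH; rewrite !size_cat leq_add //.
apply: leq_trans (leq_addr _ _); elim: C => //= l C IHC.
by rewrite size_cat -add1n leq_add //; case: l => v [].
Qed.

(** If [x] is in [L], the tableau is unsatisfiable and has a tree within [full_bound]; conversely a
    tree refutes the tableau, so no witness exists. Stated for general [P] to serve both kinds of
    trees. *)
Lemma tree_hard (P : cnf -> cnf) (L' : word -> Prop) :
  (forall F, {subset vars (P F) <= vars F}) ->
  (forall F, satisfiable F <-> satisfiable (P F)) ->
  (forall w, L' w <-> exists F k, w = encode F k /\ exists T, is_tree P F T /\ Defs.tsize T <= k) ->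
  coNP_hard L'.
Proof.
move=> Pv Ps HL' L [M [[R [c [CR HM]]] HL]].
have [d Rd] := cobham_compiles CR.
pose F x := tableau c d x.
exists (fun xs => encode (F (head [::] xs)) (full_bound (F (head [::] xs)))).
split=> [|x]; first exact/cob_encode/cobF_tableau/Rd.
split=> [/HL unM|/HL'[F' [k [/encode_inj[<- <-] [T [HT _]]]]]].
  have unF : ~ satisfiable (F x) by move=> /(tableauP c Rd)/HM.
  have [T [HT sT]] := unsat_tree Pv Ps (leqW (size_vars_enc (F x))) unF.
  apply/HL'; exists (F x), (full_bound (F x)); split=> //; exists T.
  by rewrite -ltnS full_boundE.
apply/HL => /HM/(tableauP c Rd); exact: (tree_unsat Ps HT).
Qed.

Theorem theorem2 : coNP_hard OTS_DST /\ coNP_hard OTS_BST.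
Proof.
split.
  apply: (tree_hard D_vars D_satisfiable) => w; split=> -[F [k [e [T [HT sT]]]]];
    by exists F, k; split=> //; exists T; rewrite ?is_tree_DST // -is_tree_DST.
apply: (@tree_hard id _ (fun F x xF => xF) (fun F => iff_refl _)) => w;
  split=> -[F [k [e [T [HT sT]]]]];
  by exists F, k; split=> //; exists T; rewrite ?is_tree_BST // -is_tree_BST.
Qed.
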